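(* Let $\Gamma$ be a rational smooth affine curve and let $g\in\mathrm{Aut}(\Gamma)$. (1) If $g$ fixes at most one point of $\Gamma$, then there exist a closed embedding $\tau\colon\Gamma\to\mathbb{A}^2$ and $h\in\mathrm{Aut}(\mathbb{A}^2)$ with $h\circ\tau=\tau\circ g$. (2) If $g$ has finite order $n>1$ with $n$ odd and $g$ fixes exactly two points of $\Gamma$, then there is no closed embedding $\tau\colon\Gamma\to\mathbb{A}^2$ for which there exists $h\in\mathrm{Aut}(\mathbb{A}^2)$ with $h\circ\tau=\tau\circ g$.
   Context: All varieties are over $\mathbb{C}$. A rational smooth affine curve is a smooth affine curve isomorphic to $\mathbb{P}^1\setminus\Lambda$ for some non-empty finite set $\Lambda\subset\mathbb{P}^1$; its automorphisms are identified with the automorphisms of $\mathbb{P}^1$ preserving $\Lambda$. *)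

(* Defs.v *)
From HB Require Import structures.
From mathcomp Require Import all_boot all_order all_algebra all_field.
Set Implicit Arguments. Unset Strict Implicit. Unset Printing Implicit Defensive.
Import Order.TTheory GRing.Theory Num.Theory.
Local Open Scope ring_scope.

(* The projective line P^1(K) : [Some x] is the affine point x, [None] is infinity. *)
Definition P1 (K : fieldType) := option K.

Definition mob (K : fieldType) (a b c d : K) (p : option K) : option K :=
  match p with
  | Some x => if c * x + d == 0 then None else Some ((a * x + b) / (c * x + d))
  | None => if c == 0 then None else Some (a / c)
  end.

Definition isMobius (K : fieldType) (g : option K -> option K) : Prop :=
  exists a b c d : K, a * d - b * c != 0 /\ forall p, g p = mob a b c d p.

(* g is an automorphism of Gamma = P^1 \ L, i.e. an automorphism of P^1 preserving L. *)
Definition autCurve (K : fieldType) (L : seq (option K)) (g : option K -> option K) : Prop :=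
  isMobius g /\ forall p, (g p \in L) = (p \in L).

Definition onCurve (K : fieldType) (L : seq (option K)) (p : option K) : bool := p \notin L.

Definition regular (K : fieldType) (L : seq (option K)) (f : option K -> K) : Prop :=
  exists P Q : {poly K},
    (forall x : K, onCurve L (Some x) -> Q.[x] != 0 /\ f (Some x) = P.[x] / Q.[x]) /\
    (onCurve L None -> (size P <= size Q)%N /\
        f None = (if size P == size Q then lead_coef P / lead_coef Q else 0)).

(* Polynomials in two variables x, y: an element of {poly {poly K}} where the
   outer variable is y and the coefficients are polynomials in x. *)
Definition ev2 (K : fieldType) (P : {poly {poly K}}) (x y : K) : K := (P.[y%:P]).[x].

Definition polyAut (K : fieldType) (h1 h2 : {poly {poly K}}) : Prop :=
  exists k1 k2 : {poly {poly K}},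
    forall x y : K,
      [/\ ev2 k1 (ev2 h1 x y) (ev2 h2 x y) = x, ev2 k2 (ev2 h1 x y) (ev2 h2 x y) = y,
          ev2 h1 (ev2 k1 x y) (ev2 k2 x y) = x & ev2 h2 (ev2 k1 x y) (ev2 k2 x y) = y].

(* tau = (f1, f2) : Gamma -> A^2 is a closed embedding: a morphism whose
   comorphism K[x,y] -> O(Gamma) is surjective. *)
Definition closedEmb (K : fieldType) (L : seq (option K)) (f1 f2 : option K -> K) : Prop :=
  [/\ regular L f1, regular L f2 &
      forall phi, regular L phi -> exists P : {poly {poly K}},
        forall p, onCurve L p -> phi p = ev2 P (f1 p) (f2 p)].

Definition extendsAlong (K : fieldType) (L : seq (option K)) (f1 f2 : option K -> K)
    (g : option K -> option K) : Prop :=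
  exists h1 h2 : {poly {poly K}}, polyAut h1 h2 /\
    forall p, onCurve L p ->
      ev2 h1 (f1 p) (f2 p) = f1 (g p) /\ ev2 h2 (f1 p) (f2 p) = f2 (g p).

Definition fixesAtMostOne (K : fieldType) (L : seq (option K)) (g : option K -> option K) :=
  forall p q, onCurve L p -> onCurve L q -> g p = p -> g q = q -> p = q.

Definition fixesExactlyTwo (K : fieldType) (L : seq (option K)) (g : option K -> option K) :=
  exists p q, [/\ onCurve L p /\ onCurve L q, p != q, g p = p, g q = q &
    forall r, onCurve L r -> g r = r -> r = p \/ r = q].

Definition hasOrder (T : Type) (g : T -> T) (n : nat) : Prop :=
  (0 < n)%N /\ (forall p, iter n g p = p) /\
  (forall m, (0 < m < n)%N -> exists p, iter m g p <> p).

(* Main.v *)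
Require Import Defs.
From Stdlib Require Import Classical.
From HB Require Import structures.
From mathcomp Require Import all_boot all_order all_algebra all_field.
From mathcomp Require Import ring zify.
Set Implicit Arguments. Unset Strict Implicit. Unset Printing Implicit Defensive.
Import GRing.Theory.
Local Open Scope ring_scope.

(* Part 1: g has a fixed point in L.  Otherwise its only fixed point lies on the curve, and moving
   it to infinity makes g a nontrivial translation that preserves a nonempty finite set.  Move a
   fixed point in L to infinity; then g x = a x + b, and x |-> (x, 1 / Q x), where Q has simple zeros
   at the finite points of L, is a closed embedding equivariant for a diagonal affine map.

   Part 2: move the two fixed points to 0 and infinity, so that g x = z x.  The ideal of the embedded
   curve is generated by one polynomial F, and F o h = c F for a constant c; the Jacobian determinant
   of h is a constant J.  At a fixed point of multiplier w the tangent direction is an eigenvector of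
   dh for w, and dF is nonzero and an eigenvector of the transpose of dh for c, hence J = w c.  The
   multipliers at 0 and infinity are z and 1 / z, hence z ^ 2 = 1, which excludes odd order. *)

(** * Polynomials in two variables *)

Section Bivariate.
Variable K : closedFieldType.
Implicit Types (P Q U V F G : {poly {poly K}}) (x y r : K).

(** The scalars, x ([('X)%:P]) and y (['X]) generate K[x, y] as a ring. *)
Lemma poly2_ind (T : {poly {poly K}} -> Prop) :
  (forall c : K, T c%:P%:P) -> T ('X)%:P -> T 'X ->
  (forall P Q, T P -> T Q -> T (P + Q)) ->
  (forall P Q, T P -> T Q -> T (P * Q)) -> forall P, T P.
Proof.
move=> TC TX TY TD TM.
have TP (p : {poly K}) : T p%:P.
  elim/poly_ind: p => [|p c IH]; first by rewrite -polyC0; apply: TC.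
  by rewrite polyCD polyCM; apply: TD (TC _); apply: TM.
by elim/poly_ind=> [|P p IH]; [rewrite -polyC0; apply: TP | apply: TD (TP _); apply: TM].
Qed.

Lemma ev2D P Q x y : ev2 (P + Q) x y = ev2 P x y + ev2 Q x y.
Proof. by rewrite /ev2 !hornerD. Qed.

Lemma ev2B P Q x y : ev2 (P - Q) x y = ev2 P x y - ev2 Q x y.
Proof. by rewrite /ev2 !hornerE. Qed.

Lemma ev2M P Q x y : ev2 (P * Q) x y = ev2 P x y * ev2 Q x y.
Proof. by rewrite /ev2 !hornerM. Qed.

Lemma ev2C c x y : ev2 c%:P%:P x y = c.
Proof. by rewrite /ev2 !hornerC. Qed.

Lemma ev2_0 x y : ev2 (0 : {poly {poly K}}) x y = 0.
Proof. by rewrite -!polyC0 ev2C. Qed.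

Lemma ev2_1 x y : ev2 (1 : {poly {poly K}}) x y = 1.
Proof. by rewrite -!polyC1 ev2C. Qed.

Lemma ev2X x y : ev2 ('X)%:P x y = x.
Proof. by rewrite /ev2 hornerC hornerX. Qed.

Lemma ev2Y x y : ev2 'X x y = y.
Proof. by rewrite /ev2 hornerX hornerC. Qed.

Lemma ev2XnYm i j x y : ev2 (('X^i)%:P * 'X^j) x y = x ^+ i * y ^+ j.
Proof. by rewrite ev2M /ev2 !hornerE. Qed.

Lemma ev2_sum (I : Type) (s : seq I) (E : I -> {poly {poly K}}) x y :
  ev2 (\sum_(i <- s) E i) x y = \sum_(i <- s) ev2 (E i) x y.
Proof. by rewrite /ev2 !horner_sum. Qed.

Definition ev2E := (ev2B, ev2D, ev2M, ev2C, ev2_0, ev2_1, ev2X, ev2Y).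

(** Otherwise the product of [p] with all ['X - a%:P], a in [s], would be a nonzero polynomial
    vanishing everywhere, impossible over an algebraically closed field. *)
Lemma poly_eq0_off (s : seq K) (p : {poly K}) :
  (forall x, x \notin s -> p.[x] = 0) -> p = 0.
Proof.
move=> p0; apply/eqP/negPn/negP => pN0.
have /closed_nonrootP[x] : p * \prod_(a <- s) ('X - a%:P) != 0.
  by rewrite mulf_neq0 // monic_neq0 // monic_prod_XsubC.
rewrite rootM root_prod_XsubC negb_or => /andP[/rootPf p1 xs].
by move: p1; rewrite /root p0 // eqxx.
Qed.

Lemma exists_notin (s : seq K) : exists x, x \notin s.
Proof.
have /closed_nonrootP[x] : \prod_(a <- s) ('X - a%:P) != 0.
  by rewrite monic_neq0 // monic_prod_XsubC.
by rewrite root_prod_XsubC; exists x.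
Qed.

(** Lets identities in K[x, y] be checked pointwise. For fixed x the specialized polynomial in y is
    zero, so each coefficient vanishes at every x. *)
Lemma ev2_ext P Q : (forall x y, ev2 P x y = ev2 Q x y) -> P = Q.
Proof.
move=> PQ; apply/eqP; rewrite -subr_eq0; apply/eqP/polyP => j.
have PQ0 x y : ev2 (P - Q) x y = 0 by rewrite ev2B PQ subrr.
rewrite coef0; apply: (@poly_eq0_off [::]) => x _.
have -> : ((P - Q)`_j).[x] = (map_poly (horner_eval x) (P - Q))`_j by rewrite coef_map.
rewrite (_ : map_poly _ _ = 0) ?coef0 //; apply: (@poly_eq0_off [::]) => y _.
by rewrite -[y](hornerC y x) -[_%:P.[x]]/(horner_eval x y%:P) horner_map /= -[RHS](PQ0 x y).
Qed.

Definition dX P := map_poly (@deriv K) P.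

Lemma dXD P Q : dX (P + Q) = dX P + dX Q.
Proof. by apply/polyP=> i; rewrite !(coefD, coef_map) /= derivD. Qed.

Lemma dXM P Q : dX (P * Q) = dX P * Q + P * dX Q.
Proof.
apply/polyP=> i; rewrite !(coefD, coef_map, coefM) /= raddf_sum -big_split /=.
by apply: eq_bigr => j _; rewrite derivM !coef_map.
Qed.

Lemma dXC p : dX p%:P = (p^`())%:P.
Proof. by rewrite /dX map_polyC. Qed.

Lemma dX_Y : dX 'X = 0.
Proof. by apply/polyP=> i; rewrite coef_map !coefX coef0; case: eqP; rewrite //= ?derivC ?deriv0. Qed.

Definition jac U V x y :=
  ev2 (dX U) x y * ev2 V^`() x y - ev2 U^`() x y * ev2 (dX V) x y.

(** [W] is P(U, V), known only through its values and, by the chain rule, its partial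
    derivatives. *)
Lemma comp2 P U V : exists W,
  [/\ forall x y, ev2 W x y = ev2 P (ev2 U x y) (ev2 V x y),
      forall x y, ev2 (dX W) x y =
        ev2 (dX P) (ev2 U x y) (ev2 V x y) * ev2 (dX U) x y +
        ev2 P^`() (ev2 U x y) (ev2 V x y) * ev2 (dX V) x y &
      forall x y, ev2 W^`() x y =
        ev2 (dX P) (ev2 U x y) (ev2 V x y) * ev2 U^`() x y +
        ev2 P^`() (ev2 U x y) (ev2 V x y) * ev2 V^`() x y].
Proof.
elim/poly2_ind: P => [c|||P Q [W [e1 e2 e3]] [W' [e1' e2' e3']]|P Q [W [e1 e2 e3]] [W' [e1' e2' e3']]].
- exists c%:P%:P; split=> x y; rewrite ?ev2C // dXC !derivC ?polyC0.
    by rewrite /ev2 !hornerE; ring.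
  by rewrite /ev2 !hornerE; ring.
- by exists U; split=> x y; rewrite ?ev2X // dXC derivX derivC /ev2 !hornerE; ring.
- by exists V; split=> x y; rewrite ?ev2Y // dX_Y derivX /ev2 !hornerE; ring.
- exists (W + W'); split=> x y; rewrite !(dXD, derivD, ev2E) ?e1 ?e1' ?e2 ?e2' ?e3 ?e3' //; ring.
- exists (W * W'); split=> x y; rewrite !(dXM, derivM, ev2E) ?e1 ?e1' ?e2 ?e2' ?e3 ?e3' //; ring.
Qed.

Lemma unit_poly2 P Q : P * Q = 1 -> exists2 c : K, c != 0 & P = c%:P%:P.
Proof.
move=> PQ.
have: P \is a GRing.unit by apply/unitrPr; exists Q.
rewrite poly_unitE => /andP[/eqP/eq_leq/size1_polyC->].
rewrite coefC eqxx poly_unitE => /andP[/eqP/eq_leq/size1_polyC->].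
by rewrite coefC unitfE; exists (P`_0)`_0.
Qed.

(** By the chain rule, the Jacobian of h times that of its inverse, composed with h, is 1; so it is
    a unit of K[x, y], that is, a constant. *)
Lemma jac_const h1 h2 : polyAut h1 h2 -> exists J : K, forall x y, jac h1 h2 x y = J.
Proof.
move=> [k1 [k2 hk]].
have [W1 [w1 w1x w1y]] := comp2 k1 h1 h2.
have [W2 [w2 w2x w2y]] := comp2 k2 h1 h2.
have W1E : W1 = ('X)%:P by apply: ev2_ext => x y; rewrite w1 ev2X; case: (hk x y).
have W2E : W2 = 'X by apply: ev2_ext => x y; rewrite w2 ev2Y; case: (hk x y).
have [Z [z _ _]] := comp2 (dX k1 * k2^`() - k1^`() * dX k2) h1 h2.
have JZ : (dX h1 * h2^`() - h1^`() * dX h2) * Z = 1.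
  apply: ev2_ext => x y; move: (w1x x y) (w1y x y) (w2x x y) (w2y x y).
  rewrite W1E W2E dXC dX_Y !derivX derivC ?polyC1 !(ev2_0, ev2_1) !ev2E z !ev2E => A B C D.
  (* The product of the two Jacobian matrices is the identity, entry by entry in [A], [B], [C], [D];
     take determinants. *)
  have det u v w z' : 1 = u :> K -> 0 = v -> 0 = w -> 1 = z' -> u * z' - v * w = 1.
    by move=> <- <- <- <-; ring.
  by rewrite -(det _ _ _ _ A B C D); ring.
have [J _ JE] := unit_poly2 JZ.
by exists J => x y; rewrite /jac -!ev2M -ev2B JE ev2C.
Qed.

(** * Divisibility and prime ideals in K[x, y] *)

Lemma vanish_at_dvd r P : map_poly (horner_eval r) P = 0 ->
  exists Q, P = ('X - r%:P)%:P * Q.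
Proof.
move=> P0; exists (map_poly (fun p => p %/ ('X - r%:P)) P); apply/polyP=> i.
rewrite coefCM coef_map_id0 ?div0p // mulrC divpK // dvdp_XsubCl.
by apply/rootP; have := congr1 (fun p : {poly K} => p`_i) P0; rewrite coef_map coef0.
Qed.

(** A form of Gauss's lemma: [F] has no factor x - r. If x - r divides [c], then Q(r, y) F(r, y) = 0
    forces x - r to divide [Q], so the linear factors of [c] cancel one at a time. *)
Lemma scale_divides F G (c : {poly K}) :
  (forall r, map_poly (horner_eval r) F != 0) -> c != 0 ->
  forall Q, c *: G = Q * F -> exists Q', G = Q' * F.
Proof.
move=> prF; have [n] := ubnP (size c); elim: n c => // n IH c szc c0 Q cG.
have [/eqP/eq_leq/size1_polyC|/closed_rootP[r rc]] := boolP (size c == 1).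
  move: (c`_0) => e cE; move: c0 cG; rewrite cE polyC_eq0 => e0 cG.
  exists (e^-1%:P *: Q).
  by rewrite -scalerAl -cG scalerA -polyCM mulVf // polyC1 scale1r.
have /factor_theorem[d dE] := rc.
have Q0 : map_poly (horner_eval r) Q = 0.
  have := congr1 (map_poly (horner_eval r)) cG.
  rewrite rmorphM /= map_polyZ /= /horner_eval (rootP rc) scale0r => /esym/eqP.
  by rewrite mulf_eq0 (negPf (prF r)) orbF => /eqP.
have [Q' QE] := vanish_at_dvd Q0.
have Xr0 : 'X - r%:P != 0 by rewrite polyXsubC_eq0.
have d0 : d != 0 by apply: contraNneq c0 => d0; rewrite dE d0 mul0r.
apply: (IH d _ _ Q') => //.
  by move: szc; rewrite dE size_Mmonic ?monicXsubC // size_XsubC addn2.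
have XrC0 : ('X - r%:P)%:P != 0 by rewrite polyC_eq0.
by apply: (mulfI XrC0); rewrite !mul_polyC scalerA mulrC -dE cG QE -mulrA mul_polyC.
Qed.

Lemma exists_minimal (T : Type) (A : T -> Prop) (f : T -> nat) :
  (exists t, A t) -> exists t, A t /\ forall u, A u -> (f t <= f u)%N.
Proof.
case=> t; have [n] := ubnP (f t); elim: n t => // n IH t lttn At.
have [[u [Au ltut]]|nex] := classic (exists u, A u /\ (f u < f t)%N).
  by apply: (IH u) => //; apply: leq_trans ltut _.
by exists t; split=> // u Au; rewrite leqNgt; apply/negP=> ltut; case: nex; exists u.
Qed.

(* [not_pt] excludes the maximal ideals of K[x, y], so that I has height one. *)
Lemma prime_ideal_principal (I : {poly {poly K}} -> Prop)
  (I_sub : forall P Q, I P -> I Q -> I (P - Q))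
  (I_mul : forall P Q, I Q -> I (P * Q)) (I_1 : ~ I 1)
  (I_prime : forall P Q, I (P * Q) -> I P \/ I Q)
  (not_pt : forall r s, ~ (I ('X - r%:P)%:P /\ I ('X - s%:P%:P)))
  (I_neq0 : exists P, I P /\ P != 0) :
  exists F, I F /\ forall G, I G -> exists Q, G = Q * F.
Proof.
have [[r Ir]|noX] := classic (exists r, I ('X - r%:P)%:P).
  (* [map_poly polyC p] is p(y). If it were in I, primality would put some factor y - s in I,
     against [not_pt]. *)
  have noC (p : {poly K}) : p != 0 -> ~ I (map_poly polyC p).
    have [n] := ubnP (size p); elim: n p => // n IH p szp p0.
    have [/eqP/eq_leq/size1_polyC|/closed_rootP[s /factor_theorem[q pE]]] := boolP (size p == 1).
      move: (p`_0) => c pE Ip; have c0 : c != 0 by rewrite -polyC_eq0 -pE.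
      have := I_mul c^-1%:P%:P _ Ip; rewrite pE map_polyC /= -polyCM.
      by rewrite -[_%:P * _]polyCM mulVf // !polyC1.
    have q0 : q != 0 by apply: contraNneq p0 => q0; rewrite pE q0 mul0r.
    rewrite pE rmorphM /= rmorphB /= map_polyX map_polyC /= => /I_prime[].
      by apply: IH => //; move: szp; rewrite pE size_Mmonic ?monicXsubC // size_XsubC addn2.
    by move=> Is; apply: (not_pt r s).
  exists ('X - r%:P)%:P; split=> // G IG.
  (* [p] is G(r, y), which differs from [G] by a multiple of x - r. *)
  set p := map_poly (horner_eval r) G.
  have [Q GQ] : exists Q, G - map_poly polyC p = ('X - r%:P)%:P * Q.
    apply: vanish_at_dvd; apply/polyP=> i.
    by rewrite rmorphB coefB !coef_map coef0 /= !/(horner_eval _ _) hornerC subrr.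
  have [p0|/noC[]] := eqVneq p 0.
    by exists Q; rewrite mulrC -GQ p0 rmorph0 subr0.
  have -> : map_poly polyC p = G - Q * ('X - r%:P)%:P by rewrite [Q * _]mulrC -GQ subKr.
  by apply: I_sub => //; apply: I_mul.
(* [F] has least y-degree among the nonzero elements of I and, for that y-degree, a leading
   coefficient of least x-degree. *)
have [F0 [[IF0 F00] minF0]] := exists_minimal (fun P => size P) I_neq0.
have [F [[[IF Fn0] szF] minF]] := @exists_minimal _
  (fun P => (I P /\ P != 0) /\ size P = size F0) (fun P => size (lead_coef P))
  (ex_intro _ F0 (conj (conj IF0 F00) erefl)).
exists F; split=> // G IG.
(* If x - r divided [F], the quotient would be in I with the same y-degree and a leading coefficient
   of smaller degree. *)
have prF r : map_poly (horner_eval r) F != 0.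
  apply/eqP => /vanish_at_dvd[F' FE].
  have := IF; rewrite FE => /I_prime[Ir|IF']; first by case: noX; exists r.
  have F'0 : F' != 0 by apply: contraNneq Fn0 => F'0; rewrite FE F'0 mulr0.
  have szF' : size F' = size F0.
    by rewrite -szF FE size_Cmul // polyXsubC_eq0.
  have := minF F' (conj (conj IF' F'0) szF').
  rewrite FE lead_coefM lead_coefC size_monicM ?monicXsubC ?lead_coef_eq0 //.
  by rewrite size_XsubC ltnn.
(* Pseudo-division: minimality of the y-degree kills the remainder, and [scale_divides] removes the
   power [c] of the leading coefficient. *)
have := Pdiv.Idomain.divp_eq G F; set c := _ ^+ _; set Q := G %/ F => GE.
have R0 : G %% F = 0.
  apply/eqP/negPn/negP => R0.
  have : I (G %% F).
    rewrite -[G %% F](addKr (Q * F)) -GE addrC -mul_polyC; apply: I_sub; exact: I_mul.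
  move=> IR; have := minF0 _ (conj IR R0).
  by rewrite leqNgt -szF Pdiv.Idomain.ltn_modp Fn0.
apply: (scale_divides prF (_ : c != 0) (Q := Q)).
  by rewrite expf_neq0 // lead_coef_eq0.
by rewrite GE R0 addr0.
Qed.

End Bivariate.

(** * Regular functions *)

Section Regular.
Variable K : closedFieldType.
Implicit Types (P Q : {poly K}) (p q : option K) (L : seq (option K)) (f : option K -> K).

(* The value at p = (x : 1) or (1 : 0) of the degree N homogenization of P. *)
Definition hval (N : nat) P p : K := if p is Some x then P.[x] else P`_N.

Lemma hvalD N P Q p : hval N (P + Q) p = hval N P p + hval N Q p.
Proof. by case: p => [x|]; rewrite /= ?hornerD ?coefD. Qed.

Lemma hvalZ N (c : K) P p : hval N (c *: P) p = c * hval N P p.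
Proof. by case: p => [x|]; rewrite /= ?hornerZ ?coefZ. Qed.

Lemma hval_sum N (I : Type) (s : seq I) (E : I -> {poly K}) p :
  hval N (\sum_(i <- s) E i) p = \sum_(i <- s) hval N (E i) p.
Proof. by case: p => [x|]; rewrite /= ?horner_sum ?coef_sum. Qed.

Lemma hval0 N p : hval N 0 p = 0.
Proof. by case: p => [x|]; rewrite /= ?horner0 ?coef0. Qed.

Lemma size_mul_deg N M P Q : (size P <= N.+1)%N -> (size Q <= M.+1)%N ->
  (size (P * Q)%R <= (N + M).+1)%N.
Proof.
move=> sP sQ; apply: leq_trans (size_polyMleq _ _) _.
by rewrite -subn1 leq_subLR add1n -addSn -addnS leq_add.
Qed.

Lemma hvalM N M P Q p : (size P <= N.+1)%N -> (size Q <= M.+1)%N ->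
  hval (N + M) (P * Q) p = hval N P p * hval M Q p.
Proof.
move=> sP sQ; case: p => [x|] /=; first by rewrite hornerM.
have ltN : (N < (N + M).+1)%N by rewrite ltnS leq_addr.
rewrite coefM (bigD1 (Ordinal ltN)) //= addKn big1 ?addr0 // => j jN.
have {jN}: (j : nat) != N by apply: contraNneq jN => jN; apply/eqP/val_inj.
rewrite neq_ltn => /orP[lt_jN|lt_Nj].
  by rewrite [Q`__]nth_default ?mulr0 // (leq_trans sQ) // ltn_subRL ltn_add2r.
by rewrite [P`__]nth_default ?mul0r // (leq_trans sP).
Qed.

Lemma size_exp_deg P n : (size P <= 2)%N -> (size (P ^+ n)%R <= n.+1)%N.
Proof.
move=> sP; elim: n => [|n IH]; first by rewrite expr0 size_poly1.
by rewrite exprS; apply: (@size_mul_deg 1 n).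
Qed.

Lemma hvalX P n p : (size P <= 2)%N -> hval n (P ^+ n) p = hval 1 P p ^+ n.
Proof.
move=> sP; elim: n => [|n IH]; first by case: p => [x|]; rewrite !expr0 /= ?hornerC ?coef1.
by rewrite !exprS -IH -(@hvalM 1 n) ?size_exp_deg.
Qed.

(** A common degree bound [N] for numerator and denominator puts infinity on the same footing as the
    other points. *)
Definition regularH L f := exists (N : nat) P Q,
  [/\ (size P <= N.+1)%N, (size Q <= N.+1)%N & forall p, onCurve L p ->
    hval N Q p != 0 /\ f p = hval N P p / hval N Q p].

Lemma exists_onCurve L (s : seq K) : exists x, onCurve L (Some x) /\ x \notin s.
Proof.
have [x] := exists_notin (pmap id L ++ s); rewrite mem_cat negb_or mem_pmap map_id.
by case/andP; exists x.
Qed.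

Lemma regularP L f : regular L f <-> regularH L f.
Proof.
split=> [[P [Q [PQx PQi]]]|[N [P [Q [sP sQ PQ]]]]]; last first.
  exists P, Q; split=> [x Gx|Gi]; first by have := PQ _ Gx.
  have /= [QN ->] := PQ _ Gi.
  have szQ : size Q = N.+1.
    by apply/eqP; rewrite eqn_leq sQ ltnNge; apply: contra QN => ?; rewrite nth_default.
  rewrite szQ; split=> //; case: eqP => szP; first by rewrite !lead_coefE szP szQ.
  rewrite [P`_N]nth_default ?mul0r // -ltnS ltn_neqAle sP andbT; exact/eqP.
have [x [Gx _]] := exists_onCurve L [::].
have Q0 : Q != 0 by apply: contraTneq (PQx x Gx).1 => ->; rewrite horner0 eqxx.
have sQ0 : (0 < size Q)%N by rewrite size_poly_gt0.
have [Gi|Li] := boolP (onCurve L None).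
  (* With N the degree of [Q], the value of [Q] at infinity is its leading coefficient, hence
     nonzero. *)
  have [sPQ fi] := PQi Gi; exists (size Q).-1, P, Q; rewrite prednK //; split=> // -[y|] Gy.
    by have := PQx y Gy.
  rewrite /= -lead_coefE lead_coef_eq0 Q0 fi; split=> //.
  case: eqP => sP; first by rewrite lead_coefE sP.
  by rewrite nth_default ?mul0r // -ltnS prednK // ltn_neqAle sPQ andbT; apply/eqP.
(* Infinity is not on the curve here, so any common bound will do. *)
exists (maxn (size P) (size Q)), P, Q; split; rewrite ?leqW ?leq_maxl ?leq_maxr //.
by move=> [y|] Gy; [have := PQx y Gy | rewrite Gy in Li].
Qed.

Lemma regular_ext L f g : (forall p, onCurve L p -> f p = g p) -> regularH L f -> regularH L g.
Proof.
move=> fg [N [P [Q [sP sQ PQ]]]]; exists N, P, Q; split=> // p Gp.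
by rewrite -fg //; apply: PQ.
Qed.

Lemma regularH_frac L (N : nat) P Q : (size P <= N.+1)%N -> (size Q <= N.+1)%N ->
  (forall p, onCurve L p -> hval N Q p != 0) ->
  regularH L (fun p => hval N P p / hval N Q p).
Proof. by move=> sP sQ Q0; exists N, P, Q; split=> // p /Q0. Qed.

Lemma regular_const L (c : K) : regularH L (fun=> c).
Proof.
exists 0%N, c%:P, 1; rewrite size_polyC size_poly1; split=> //; first by case: eqP.
by move=> [x|] _; rewrite /= ?hornerC ?coefC ?coef1 /= divr1 oner_neq0.
Qed.

Lemma regularD L f g : regularH L f -> regularH L g -> regularH L (fun p => f p + g p).
Proof.
move=> [N [P [Q [sP sQ PQ]]]] [N' [P' [Q' [sP' sQ' PQ']]]].
exists (N + N')%N, (P * Q' + Q * P'), (Q * Q'); split; rewrite ?size_mul_deg //.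
  by apply: leq_trans (size_polyD _ _) _; rewrite geq_max !size_mul_deg.
move=> p Gp; have [Q0 ->] := PQ p Gp; have [Q'0 ->] := PQ' p Gp.
rewrite hvalD !hvalM // mulf_neq0 //; split=> //.
by rewrite addf_div // [hval N' P' p * _]mulrC.
Qed.

Lemma regularM L f g : regularH L f -> regularH L g -> regularH L (fun p => f p * g p).
Proof.
move=> [N [P [Q [sP sQ PQ]]]] [N' [P' [Q' [sP' sQ' PQ']]]].
exists (N + N')%N, (P * P'), (Q * Q'); split; rewrite ?size_mul_deg //.
move=> p Gp; have [Q0 ->] := PQ p Gp; have [Q'0 ->] := PQ' p Gp.
by rewrite !hvalM // mulf_neq0 // mulf_div.
Qed.

Lemma regularB L f g : regularH L f -> regularH L g -> regularH L (fun p => f p - g p).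
Proof.
move=> rf rg; apply: (@regular_ext _ (fun p => f p + -1 * g p)) => [p _|].
  by rewrite mulN1r.
by apply: regularD => //; apply: regularM => //; apply: regular_const.
Qed.

Lemma regular_ev2 L f g (G : {poly {poly K}}) :
  regularH L f -> regularH L g -> regularH L (fun p => ev2 G (f p) (g p)).
Proof.
move=> rf rg; elim/poly2_ind: G => [c|||P Q rP rQ|P Q rP rQ].
- by apply: regular_ext (regular_const L c) => p _; rewrite ev2C.
- by apply: regular_ext rf => p _; rewrite ev2X.
- by apply: regular_ext rg => p _; rewrite ev2Y.
- by apply: regular_ext (regularD rP rQ) => p _; rewrite ev2D.
- by apply: regular_ext (regularM rP rQ) => p _; rewrite ev2M.
Qed.

(** The product of the numerators vanishes off a finite set, so one numerator is the zero
    polynomial; this also settles the value at infinity. *)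
Lemma regular_domain L f g : regularH L f -> regularH L g ->
  (forall x, onCurve L (Some x) -> f (Some x) * g (Some x) = 0) ->
  (forall p, onCurve L p -> f p = 0) \/ (forall p, onCurve L p -> g p = 0).
Proof.
move=> [N [P [Q [sP sQ PQ]]]] [N' [P' [Q' [sP' sQ' PQ']]]] fg0.
have /eqP: P * P' = 0.
  apply: (@poly_eq0_off _ (pmap id L)) => x; rewrite mem_pmap map_id => Gx.
  move: (fg0 x Gx); have [/= Q0 ->] := PQ _ Gx; have [/= Q'0 ->] := PQ' _ Gx.
  move/eqP; rewrite mulf_div mulf_eq0 invr_eq0 [Q.[x] * _ == 0]mulf_eq0 (negPf Q0) (negPf Q'0).
  by rewrite !orbF -hornerM => /eqP.
rewrite mulf_eq0 => /orP[]/eqP E; [left|right] => p Gp.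
  by have [_ ->] := PQ p Gp; rewrite E hval0 mul0r.
by have [_ ->] := PQ' p Gp; rewrite E hval0 mul0r.
Qed.

Lemma regular_eq0 L f : regularH L f ->
  (forall x, onCurve L (Some x) -> f (Some x) = 0) -> forall p, onCurve L p -> f p = 0.
Proof.
move=> rf f0; case: (regular_domain rf rf) => // x Gx.
by rewrite f0 // mulr0.
Qed.

(** * Homogeneous coordinates and Moebius substitutions *)

Definition hnum p : K := if p is Some x then x else 1.
Definition hden p : K := if p is Some _ then 1 else 0.
Definition proj (u v : K) : option K := if v == 0 then None else Some (u / v).

Lemma mobE (a b c d : K) p :
  mob a b c d p = proj (a * hnum p + b * hden p) (c * hnum p + d * hden p).
Proof. by case: p => [x|]; rewrite /mob /proj /= ?mulr1 ?mulr0 ?addr0. Qed.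

(** The ratio of (u, v) to the normalized coordinates of [proj u v]; it is nonzero unless u = v =
    0. *)
Definition pscale (u v : K) := if v == 0 then u else v.

Lemma proj_num u v : hnum (proj u v) * pscale u v = u.
Proof.
by rewrite /proj /pscale; case: eqP => [_|/eqP v0] /=; rewrite ?mul1r // divfK.
Qed.

Lemma proj_den u v : hden (proj u v) * pscale u v = v.
Proof.
by rewrite /proj /pscale; case: eqP => [->|/eqP v0] /=; rewrite ?mul0r ?mul1r.
Qed.

Lemma hvalE N P p : (size P <= N.+1)%N ->
  hval N P p = \sum_(i < N.+1) P`_i * (hnum p ^+ i * hden p ^+ (N - i)).
Proof.
case: p => [x|] sP /=.
  by rewrite (horner_coef_wide x sP); apply: eq_bigr => i _; rewrite expr1n mulr1.
rewrite big_ord_recr /= subnn !expr1n !mulr1 big1 ?add0r // => i _.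
by rewrite expr0n subn_eq0 leqNgt ltn_ord /= mulr0 mulr0.
Qed.

Lemma det_neq0 (a b c d u v : K) : a * d - b * c != 0 -> (u != 0) || (v != 0) ->
  (a * u + b * v != 0) || (c * u + d * v != 0).
Proof.
move=> D; rewrite -!negb_and; apply: contra => /andP[/eqP e1 /eqP e2].
have: (a * d - b * c) * u = 0.
  by rewrite (_ : _ * u = d * (a * u + b * v) - b * (c * u + d * v)); [rewrite e1 e2; ring | ring].
have: (a * d - b * c) * v = 0.
  by rewrite (_ : _ * v = a * (c * u + d * v) - c * (a * u + b * v)); [rewrite e1 e2; ring | ring].
by do 2![move/eqP; rewrite mulf_eq0 (negPf D) /= => /eqP->]; rewrite eqxx.
Qed.

Lemma hnum_hden p : (hnum p != 0) || (hden p != 0).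
Proof. by case: p => [x|]; rewrite /= oner_eq0 ?orbT. Qed.

Lemma pscale_neq0 u v : (u != 0) || (v != 0) -> pscale u v != 0.
Proof. by rewrite /pscale; case: (v =P 0) => [_|/eqP]; rewrite ?orbF. Qed.

(** [P'] comes from substituting the two linear forms into the homogenization of [P]; the factor
    reflects homogeneity of degree [N]. *)
Lemma hval_mob N P (a b c d : K) : a * d - b * c != 0 -> (size P <= N.+1)%N ->
  exists P', (size P' <= N.+1)%N /\ forall p, hval N P' p =
   pscale (a * hnum p + b * hden p) (c * hnum p + d * hden p) ^+ N * hval N P (mob a b c d p).
Proof.
move=> D sP.
have szl (e1 e2 : K) : (size (e1 *: 'X + e2%:P)%R <= 2)%N.
  rewrite (leq_trans (size_polyD _ _)) // geq_max (leq_trans (size_scale_leq _ _)) ?size_polyX //.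
  by rewrite size_polyC; case: eqP.
have hl (e1 e2 : K) p : hval 1 (e1 *: 'X + e2%:P) p = e1 * hnum p + e2 * hden p.
  rewrite hvalD hvalZ; case: p => [x|] /=; first by rewrite hornerX hornerC mulr1.
  by rewrite coefX coefC /= mulr0 addr0.
pose l1 := a *: 'X + b%:P; pose l2 := c *: 'X + d%:P.
exists (\sum_(i < N.+1) P`_i *: (l1 ^+ i * l2 ^+ (N - i))); split.
  apply: (leq_trans (size_sum _ _ _)); apply/bigmax_leqP => i _.
  apply: (leq_trans (size_scale_leq _ _)).
  apply: leq_trans (@size_mul_deg i (N - i) _ _ _ _) _; rewrite ?size_exp_deg ?szl //.
  by rewrite subnKC // -ltnS.
move=> p; rewrite hval_sum (hvalE _ sP) mulr_sumr mobE; apply: eq_bigr => i _.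
have leiN : (i <= N)%N by rewrite -ltnS.
set u := a * _ + _; set v := c * _ + _.
have hm : hval N (l1 ^+ i * l2 ^+ (N - i)) p = u ^+ i * v ^+ (N - i).
  have := hvalM p (size_exp_deg i (szl a b)) (size_exp_deg (N - i) (szl c d)).
  by rewrite (subnKC leiN) (hvalX _ _ (szl a b)) (hvalX _ _ (szl c d)) !hl.
have sN : pscale u v ^+ N = pscale u v ^+ i * pscale u v ^+ (N - i) by rewrite -exprD subnKC.
rewrite hvalZ hm sN -[u in LHS](proj_num u v) -[X in _ * (_ * X ^+ _) = _](proj_den u v).
by rewrite !exprMn; ring.
Qed.

(** Numerator and denominator pick up the same nonzero factor, which cancels. *)
Lemma regular_mob L L' f m : isMobius m -> (forall p, (p \in L') = (m p \in L)) ->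
  regularH L f -> regularH L' (f \o m).
Proof.
move=> [a [b [c [d [D mE]]]]] LL' [N [P [Q [sP sQ PQ]]]].
have [P' [sP' hP']] := hval_mob D sP; have [Q' [sQ' hQ']] := hval_mob D sQ.
exists N, P', Q'; split=> // p Gp.
have Gmp : onCurve L (m p) by rewrite /onCurve -LL'.
have [Q0 fE] := PQ _ Gmp.
have s0 := pscale_neq0 (det_neq0 D (hnum_hden p)).
rewrite hP' hQ' -mE mulf_neq0 ?expf_neq0 //; split=> //.
by rewrite /= fE -mulf_div divff ?mul1r // expf_neq0.
Qed.

End Regular.

(** * Algebraic dependence and Moebius transformations *)

Section Curve.
Variable K : closedFieldType.
Implicit Types (p q : option K) (L : seq (option K)) (f g m : option K -> option K).

Lemma size_pow_deg (N i : nat) (P : {poly K}) :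
  (size P <= N.+1)%N -> (size (P ^+ i)%R <= (N * i).+1)%N.
Proof.
move=> sP; elim: i => [|i IH]; first by rewrite expr0 size_poly1.
by rewrite exprS mulnS; apply: size_mul_deg.
Qed.

(* Dimension count: the (D + 2)^2 monomials of bidegree at most D + 1 in f1 and f2, cleared of
   denominators, lie in a space of polynomials of dimension D (D + 1) + 1. *)
Lemma algebraic_dependence L (f1 f2 : option K -> K) : regularH L f1 -> regularH L f2 ->
  exists G : {poly {poly K}}, G != 0 /\ forall p, onCurve L p -> ev2 G (f1 p) (f2 p) = 0.
Proof.
move=> r1 r2; have [N1 [P1 [Q1 [sP1 sQ1 PQ1]]]] := r1.
have [N2 [P2 [Q2 [sP2 sQ2 PQ2]]]] := r2.
pose D := (N1 + N2)%N; pose e := D.+1; pose n := e.+1; pose d := (D * e).+1.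
have n_gt0 : (0 < n)%N by [].
(* [k] encodes the exponents i = k %/ n and j = k %% n; [mon k] is the numerator of f1^i f2^j over
   the common denominator (Q1 Q2)^e. *)
pose mon (k : nat) := P1 ^+ (k %/ n) * Q1 ^+ (e - k %/ n) * (P2 ^+ (k %% n) * Q2 ^+ (e - k %% n)).
have lei (k : 'I_(n * n)) : (k %/ n <= e)%N by rewrite -ltnS ltn_divLR.
have lej (k : nat) : (k %% n <= e)%N by rewrite -ltnS ltn_mod.
have smon (k : 'I_(n * n)) : (size (mon k) <= d)%N.
  rewrite /d mulnDl; apply: size_mul_deg.
    by rewrite -{2}(subnKC (lei k)) mulnDr size_mul_deg ?size_pow_deg.
  by rewrite -{2}(subnKC (lej k)) mulnDr size_mul_deg ?size_pow_deg.
(* Left kernel vectors of [B] are linear relations among the [mon k]; a nonzero one exists because n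
   * n > d. *)
pose B : 'M[K]_(n * n, d) := \matrix_(k, l) (mon k)`_l.
have : kermx B != 0.
  rewrite -mxrank_eq0 mxrank_ker subn_eq0 -ltnNge (leq_ltn_trans (rank_leq_col B)) //.
  by rewrite /d /n /e; nia.
case/rowV0Pn => u /sub_kermxP uB u0.
have Pu : \sum_(k < n * n) u 0 k *: mon k = 0.
  apply/polyP => l; rewrite coef_sum coef0.
  have [ltld|ledl] := ltnP l d; last first.
    by apply: big1 => k _; rewrite coefZ nth_default ?mulr0 // (leq_trans (smon k)).
  have : (u *m B) 0 (Ordinal ltld) = 0 by rewrite uB mxE.
  rewrite mxE => E; apply: etrans E.
  by apply: eq_bigr => k _; rewrite coefZ mxE.
pose G : {poly {poly K}} := \sum_(k < n * n) (u 0 k)%:P%:P * (('X^(k %/ n))%:P * 'X^(k %% n)).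
exists G; split.
  have /rV0Pn[k uk] := u0; apply: contraNneq uk => G0.
  have := congr1 (fun M : {poly {poly K}} => M`_(k %% n)`_(k %/ n)) G0.
  rewrite !coef0 coef_sum coef_sum (bigD1 k) //= big1 ?addr0 => [|k' k'k].
    by rewrite !coefCM coefXn eqxx mulr1 coefXn eqxx mulr1 => ->.
  rewrite !coefCM coefXn; case: eqP => [jj|]; rewrite ?mulr0 ?coef0 ?mulr0 // mulr1 coefXn.
  case: eqP => [ii|]; rewrite ?mulr0 //; case/eqP: k'k; apply/val_inj.
  by rewrite /= (divn_eq k' n) (divn_eq k n) jj ii.
apply: regular_eq0 => [|x Gx]; first exact: regular_ev2.
have [/= q1 ->] := PQ1 _ Gx; have [/= q2 ->] := PQ2 _ Gx.
have q0 : Q1.[x] ^+ e * Q2.[x] ^+ e != 0 by rewrite mulf_neq0 ?expf_neq0.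
apply: (mulfI q0); rewrite mulr0 ev2_sum mulr_sumr -[RHS](horner0 x) -Pu horner_sum.
apply: eq_bigr => k _; rewrite hornerZ !hornerM !horner_exp ev2M ev2C ev2XnYm.
have ex (a b : K) (i : nat) : b != 0 -> (i <= e)%N -> b ^+ e * (a / b) ^+ i = a ^+ i * b ^+ (e - i).
  move=> b0 lie; rewrite -{1}(subnKC lie) exprD expr_div_n.
  by rewrite mulrAC [b ^+ i * _]mulrC divfK ?expf_neq0.
by rewrite -!ex //; ring.
Qed.

Lemma proj_repr p : proj (hnum p) (hden p) = p.
Proof. by case: p => [x|]; rewrite /proj /= ?oner_eq0 ?divr1 ?eqxx. Qed.

Lemma proj_scale (s u v : K) : s != 0 -> proj (u * s) (v * s) = proj u v.
Proof.
move=> s0; rewrite /proj mulf_eq0 (negPf s0) orbF; case: eqP => // _.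
by rewrite invfM mulrACA divff // mulr1.
Qed.

Lemma mob_comp (a b c d a' b' c' d' : K) p : a' * d' - b' * c' != 0 ->
  mob a b c d (mob a' b' c' d' p) =
  mob (a * a' + b * c') (a * b' + b * d') (c * a' + d * c') (c * b' + d * d') p.
Proof.
move=> D; rewrite [in RHS]mobE [X in mob a b c d X]mobE.
set u := a' * _ + _; set v := c' * _ + _.
have s0 : pscale u v != 0 by apply: pscale_neq0; apply: det_neq0 D (hnum_hden p).
rewrite mobE -(proj_scale _ _ s0) !mulrDl -!mulrA proj_num proj_den /u /v.
by congr proj; ring.
Qed.

Lemma mob_scalar (e : K) p : e != 0 -> mob e 0 0 e p = p.
Proof.
by move=> e0; rewrite mobE !mul0r addr0 add0r ![e * _]mulrC proj_scale // proj_repr.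
Qed.

Lemma isMobius_comp f g : isMobius f -> isMobius g -> isMobius (f \o g).
Proof.
move=> [a [b [c [d [D fE]]]]] [a' [b' [c' [d' [D' gE]]]]].
exists (a * a' + b * c'), (a * b' + b * d'), (c * a' + d * c'), (c * b' + d * d').
split=> [|p]; last by rewrite /= fE gE mob_comp.
rewrite (_ : _ - _ = (a * d - b * c) * (a' * d' - b' * c')); first by rewrite mulf_neq0.
by ring.
Qed.

(** The columns of the matrix of [m] are the coordinates of [q] and [p]; [m'] is given by the
    adjugate matrix. *)
Lemma exists_mobius p q : p != q -> exists m m',
  [/\ isMobius m, isMobius m', cancel m m' & cancel m' m] /\ (m None = q /\ m (Some 0) = p).
Proof.
move=> pq; have D0 : hnum q * hden p - hnum p * hden q != 0.
  move: pq; case: p => [x|]; case: q => [y|] //=;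
    rewrite ?mulr1 ?mulr0 ?subr0 ?sub0r ?oppr_eq0 ?oner_neq0 // subr_eq0.
  by apply: contraNneq => ->.
have D0' : hden p * hnum q - - hnum p * - hden q != 0.
  by move: D0; rewrite mulrNN [hden p * _]mulrC.
exists (mob (hnum q) (hnum p) (hden q) (hden p)), (mob (hden p) (- hnum p) (- hden q) (hnum q)).
split; last by rewrite !mobE /= !mulr0 !mulr1 !addr0 !add0r !proj_repr.
split; first by do 4!eexists; split; first exact: D0.
- by do 4!eexists; split; first exact: D0'.
- move=> r; rewrite mob_comp // -[RHS](mob_scalar r D0); congr (mob _ _ _ _ r); ring.
- move=> r; rewrite mob_comp // -[RHS](mob_scalar r D0); congr (mob _ _ _ _ r); ring.
Qed.

Lemma mobius_fixing_infinity g : isMobius g -> g None = None ->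
  exists a b, a != 0 /\ forall x, g (Some x) = Some (a * x + b).
Proof.
move=> [a [b [c [d [D gE]]]]]; rewrite gE /=; case: eqP => // c0 _.
move: D; rewrite c0 mulr0 subr0 mulf_eq0 negb_or => /andP[a0 d0].
exists (a / d), (b / d); split=> [|x]; first by rewrite mulf_neq0 ?invr_eq0.
by rewrite gE /= c0 mul0r add0r (negPf d0) mulrDl mulrAC.
Qed.

(** * Transport along a change of coordinate on the projective line *)

Section Transport.
Variables (L L' : seq (option K)) (m m' : option K -> option K).
Hypotheses (mob_m : isMobius m) (mob_m' : isMobius m').
Hypotheses (mK : cancel m m') (m'K : cancel m' m) (LL' : forall p, (p \in L') = (m p \in L)).

Lemma closedEmb_mobius (f1 f2 : option K -> K) : closedEmb L f1 f2 -> closedEmb L' (f1 \o m) (f2 \o m).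
Proof.
move=> [/regularP r1 /regularP r2 surj].
split; [exact/regularP/(regular_mob mob_m LL' r1)|exact/regularP/(regular_mob mob_m LL' r2)|].
move=> phi /regularP rphi; have [|P hP] := surj (phi \o m').
  by apply/regularP; apply: regular_mob mob_m' _ rphi => p; rewrite LL' m'K.
by exists P => p Gp; rewrite /= -hP /= ?mK // /onCurve -LL'.
Qed.

Lemma extendsAlong_mobius (f1 f2 : option K -> K) g :
  extendsAlong L f1 f2 g -> extendsAlong L' (f1 \o m) (f2 \o m) (m' \o g \o m).
Proof.
move=> [h1 [h2 [hA hE]]]; exists h1, h2; split=> // p Gp.
by rewrite /= m'K; apply: hE; rewrite /onCurve -LL'.
Qed.

Lemma autCurve_mobius g : autCurve L g -> autCurve L' (m' \o g \o m).
Proof.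
move=> [mg Lg]; split=> [|p]; last by rewrite !LL' /= m'K Lg.
by apply: isMobius_comp => //; apply: isMobius_comp.
Qed.

End Transport.

Lemma mem_map_can L m m' p : cancel m m' -> cancel m' m -> (p \in map m' L) = (m p \in L).
Proof. by move=> mK m'K; rewrite -{1}(mK p) mem_map //; apply: can_inj m'K. Qed.

End Curve.

(** * Automorphisms with at most one fixed point *)

Section FixedPoint.
Variable K : closedFieldType.
Implicit Types (p q : option K) (L : seq (option K)) (g m : option K -> option K).

Lemma mobius_has_fixpoint g : isMobius g -> exists p, g p = p.
Proof.
move=> [a [b [c [d [D gE]]]]]; have [c0|c0] := eqVneq c 0.
  by exists None; rewrite gE /= c0 eqxx.
(* The equation x (c x + d) = a x + b of a finite fixed point. *)
pose P : {poly K} := c *: 'X^2 + ((d - a) *: 'X - b%:P).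
have sP : size P = 3%N.
  rewrite size_polyDl size_scale ?size_polyXn // ltnS (leq_trans (size_polyD _ _)) //.
  rewrite size_polyN geq_max (leq_trans (size_scale_leq _ _)) ?size_polyX //.
  by rewrite size_polyC; case: eqP.
have /closed_rootP[x /rootP] : size P != 1%N by rewrite sP.
rewrite hornerD hornerD hornerN !hornerZ hornerXn hornerX hornerC => Px; exists (Some x); rewrite gE /=.
have Px' : x * (c * x + d) = a * x + b.
  by apply/eqP; rewrite -subr_eq0; apply/eqP; rewrite -[RHS]Px; ring.
(* Otherwise [Px'] would give a x + b = 0 too, against the nonzero determinant. *)
have cxd : c * x + d != 0.
  have := det_neq0 (u := x) (v := 1) D; rewrite oner_neq0 orbT !mulr1 => /(_ isT).
  by rewrite -Px' mulf_eq0 negb_or; case: (c * x + d != 0); rewrite ?andbF.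
by rewrite (negPf cxd) -Px' mulfK.
Qed.

(** In characteristic zero the points y + k b are pairwise distinct, and [L] cannot hold
    [(size L).+1] of them. *)
Lemma translation_invariant_unbounded L (b y : K) : [pchar K] =i pred0 -> b != 0 ->
  Some y \in L -> ~ (forall x, Some x \in L -> Some (x + b) \in L).
Proof.
move=> hK b0 Ly Lb.
have Lk k : Some (y + k%:R * b) \in L.
  elim: k => [|k IH]; first by rewrite mul0r addr0.
  by rewrite -addn1 natrD mulrDl mul1r addrA; apply: Lb.
have inj : injective (fun k : nat => Some (y + k%:R * b)).
  have le_inj k j : (k <= j)%N -> k%:R * b = j%:R * b -> k = j.
    move=> lekj /(mulIf b0) /eqP; rewrite eq_sym -subr_eq0 -natrB //.
    by move/pcharf0P: hK => ->; rewrite subn_eq0 => lejk; apply/eqP; rewrite eqn_leq lekj.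
  move=> k j [/addrI E]; case/orP: (leq_total k j) => le; first exact: le_inj.
  by apply/esym/le_inj.
have sub : {subset map (fun k : nat => Some (y + k%:R * b)) (iota 0 (size L).+1) <= L}.
  by move=> _ /mapP[k _ ->].
have := uniq_leq_size _ sub; rewrite map_inj_uniq // iota_uniq size_map size_iota ltnn.
by move/(_ isT).
Qed.

Lemma exists_fixpoint_off_curve L g : [pchar K] =i pred0 -> L != [::] -> autCurve L g ->
  fixesAtMostOne L g -> exists p, p \in L /\ g p = p.
Proof.
move=> hK L0 gA fix1; have [p gp] := mobius_has_fixpoint gA.1.
have [|Gp] := boolP (p \in L); first by exists p.
have [q qp] : exists q, q != p by case: (p) => [x|]; [exists None | exists (Some 0)].
have [m [m' [[mm mm' mK m'K] [mi _]]]] := exists_mobius qp.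
pose L' := map m' L; have LL' r : (r \in L') = (m r \in L) by apply: mem_map_can.
have [g'M g'L] := autCurve_mobius mm mm' m'K LL' gA.
have [|a [b [a0 g'E]]] := mobius_fixing_infinity g'M; first by rewrite /= mi gp -mi mK.
(* A finite fixed point of the conjugate yields a fixed point of [g] other than [p]; since [p] is on
   the curve, this one is in [L]. *)
have nofix x : m' (g (m (Some x))) = Some x -> exists r, r \in L /\ g r = r.
  move=> gx; have gx' : g (m (Some x)) = m (Some x) by rewrite -{2}gx m'K.
  have [|Gx] := boolP (m (Some x) \in L); first by exists (m (Some x)).
  have /(can_inj mK) // : m None = m (Some x).
  by apply: fix1 => //; rewrite mi.
(* If a is not 1, then b / (1 - a) is fixed; if a = 1 and b = 0, everything is; what remains is a
   nontrivial translation. *)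
have [a1|a1] := eqVneq a 1; last first.
  have a1' : 1 - a != 0 by rewrite subr_eq0 eq_sym.
  apply: (nofix (b / (1 - a))); rewrite [LHS]g'E; congr Some; field; exact: a1'.
have [b0|b0] := eqVneq b 0.
  by apply: (nofix 0); rewrite [LHS]g'E b0 mulr0 addr0.
have [l L'l] : exists l, l \in L'.
  by rewrite /L'; case: (L) L0 => // l s _; exists (m' l); rewrite /= mem_head.
case: l L'l => [y|] L'y; last by case/negP: Gp; rewrite -mi -LL'.
case: (translation_invariant_unbounded hK b0 L'y) => x.
by rewrite -g'L g'E a1 mul1r.
Qed.

End FixedPoint.

(** * Equivariant embedding when infinity is a removed fixed point *)

Section AffineCurve.
Variable K : closedFieldType.

(** Each linear factor of [R] divides [Q], so one copy of [Q] per factor suffices. *)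
Lemma dvdp_exp_of_roots (R Q : {poly K}) : R != 0 -> (forall x, root R x -> root Q x) ->
  R %| Q ^+ size R.
Proof.
have [n] := ubnP (size R); elim: n R => // n IH R szR R0 RQ.
have [|/closed_rootP[r Rr]] := boolP (size R == 1%N).
  by rewrite size_poly_eq1 => R1; rewrite (eqp_dvdl _ R1) dvd1p.
have /factor_theorem[R1 RE] := Rr.
have R10 : R1 != 0 by apply: contraNneq R0 => R10; rewrite RE R10 mul0r.
have sRE : size R = (size R1).+1 by rewrite RE size_Mmonic ?monicXsubC // size_XsubC addn2.
rewrite sRE exprSr {1}RE dvdp_mul ?dvdp_XsubCl ?RQ //.
by apply: IH => // [|x R1x]; [rewrite -ltnS -sRE | apply: RQ; rewrite RE rootM R1x].
Qed.

(* The extension is linear because Q (a x + b) = a ^ deg Q * Q x. *)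
Lemma affine_automorphism_extends (L : seq (option K)) (g : option K -> option K) (a b : K) :
  None \in L -> autCurve L g -> a != 0 -> (forall x, g (Some x) = Some (a * x + b)) ->
  exists f1 f2, closedEmb L f1 f2 /\ extendsAlong L f1 f2 g.
Proof.
move=> Li [_ gL] a0 gE; pose s := undup (pmap id L).
have sE x : (x \in s) = (Some x \in L) by rewrite mem_undup mem_pmap map_id.
pose Q : {poly K} := \prod_(z <- s) ('X - z%:P).
have rootQ x : root Q x = (Some x \in L) by rewrite root_prod_XsubC sE.
have Q0 x : onCurve L (Some x) -> Q.[x] != 0 by rewrite /onCurve -rootQ.
have Gi : onCurve L None -> False by rewrite /onCurve Li.
exists (@hnum K), (fun p => (Q.[hnum p])^-1); split; first split.
- by exists 'X, 1; split=> // x _; rewrite hornerX hornerC divr1 oner_neq0.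
- by exists 1, Q; split=> // x Gx; rewrite hornerC div1r Q0.
- move=> phi [P [R [PR _]]].
  have R0 : R != 0.
    have [x [Gx _]] := exists_onCurve L [::].
    by apply: contraTneq (PR x Gx).1 => ->; rewrite horner0 eqxx.
  (* The roots of the denominator [R] lie in [L]. Hence P / R = P S / Q^(size R), a polynomial in x
     and 1 / Q. *)
  have /dvdpP[S SE] : R %| Q ^+ size R.
    apply: dvdp_exp_of_roots => // x; apply: contraLR; rewrite rootQ => Gx.
    by rewrite /root (PR x Gx).1.
  exists ((P * S)%:P * 'X^(size R)) => -[x|] Gx; last by case: (Gi Gx).
  have [Rx ->] := PR x Gx; have Qx := Q0 x Gx.
  rewrite /ev2 !hornerE /= exprVn -horner_exp SE hornerM.
  have Sx : S.[x] != 0.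
    by apply: contraNneq (expf_neq0 (size R) Qx) => Sx; rewrite -horner_exp SE hornerM Sx mul0r.
  by field; rewrite Rx Sx.
have gQ x : Q.[a * x + b] = a ^+ size s * Q.[x].
  (* The affine map permutes the roots of [Q], and each factor a x + b - (a z + b) contributes one
     a. *)
  have ps : perm_eq (map (fun z => a * z + b) s) s.
    have inj : injective (fun z => a * z + b) by move=> y z /addIr/(mulfI a0).
    apply: uniq_perm; rewrite ?map_inj_uniq ?undup_uniq // => y.
    have -> : y = a * ((y - b) / a) + b by field.
    by rewrite (mem_map inj) !sE -gL gE.
  rewrite /Q !horner_prod -(perm_big _ ps) big_map /=.
  elim: (s) => [|z t IH]; first by rewrite !big_nil mulr1.
  by rewrite !big_cons IH exprS !hornerXsubC; ring.
exists (a *: 'X + b%:P)%:P, ((a ^- size s)%:P%:P * 'X); split.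
  have ar0 := expf_neq0 (size s) a0.
  exists (a^-1 *: ('X - b%:P))%:P, ((a ^+ size s)%:P%:P * 'X) => x y.
  rewrite /ev2 !(hornerM, hornerC, hornerX, hornerZ, hornerD, hornerN).
  by move: (a ^+ size s) ar0 => c c0; split; field.
move=> [x|] Gx; last by case: (Gi Gx).
rewrite gE /= gQ /ev2 !(hornerM, hornerC, hornerX, hornerZ, hornerD); split=> //.
by rewrite invfM.
Qed.

Lemma extends_of_fixesAtMostOne (L : seq (option K)) (g : option K -> option K) :
  [pchar K] =i pred0 -> L != [::] -> autCurve L g -> fixesAtMostOne L g ->
  exists f1 f2 : option K -> K, closedEmb L f1 f2 /\ extendsAlong L f1 f2 g.
Proof.
move=> hK L0 gA fix1; have [p [Lp gp]] := exists_fixpoint_off_curve hK L0 gA fix1.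
have [q qp] : exists q, q != p by case: (p) => [x|]; [exists None | exists (Some 0)].
have [m [m' [[mm mm' mK m'K] [mi _]]]] := exists_mobius qp.
pose L' := map m' L; have LL' r : (r \in L') = (m r \in L) by apply: mem_map_can.
have g'A := autCurve_mobius mm mm' m'K LL' gA.
have [|a [b [a0 g'E]]] := mobius_fixing_infinity g'A.1; first by rewrite /= mi gp -mi mK.
have [|f1 [f2 [fE fg]]] := affine_automorphism_extends _ g'A a0 g'E; first by rewrite LL' mi.
have L'L r : (r \in L) = (m' r \in L') by rewrite LL' m'K.
exists (f1 \o m'), (f2 \o m'); split; first exact: (closedEmb_mobius mm' mm m'K mK L'L fE).
have [h1 [h2 [hA hE]]] := extendsAlong_mobius mK L'L fg.
by exists h1, h2; split=> // r Gr; have := hE r Gr; rewrite /= !m'K.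
Qed.

End AffineCurve.

(** * Derivatives at a point of the curve *)

Section Tangent.
Variables (K : closedFieldType) (L : seq (option K)) (l : K).
Hypotheses (Ll : Some l \in L) (G0 : onCurve L (Some 0)).
Implicit Types (f : option K -> K).

Let l0 : l != 0.
Proof. by apply: contraNneq G0 => <-. Qed.

(** The coordinate x would have a pole at infinity, which may lie on the curve; x / (x - l) has its
    only pole at the removed point [l]. *)
Definition param (p : option K) : K := hval 1 'X p / hval 1 ('X - l%:P) p.

Lemma param_den_neq0 p : onCurve L p -> hval 1 ('X - l%:P) p != 0.
Proof.
case: p => [x|] Gp /=; last by rewrite coefB coefX coefC subr0 oner_neq0.
by rewrite hornerXsubC subr_eq0; apply: contraNneq Gp => ->.
Qed.

Lemma param0 : param (Some 0) = 0.
Proof. by rewrite /param /= hornerX mul0r. Qed.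

Lemma param_eq0 x : onCurve L (Some x) -> (param (Some x) == 0) = (x == 0).
Proof.
by move=> /param_den_neq0 /negPf D; rewrite /param mulf_eq0 invr_eq0 D orbF /= hornerX.
Qed.

Lemma regular_param : regularH L param.
Proof.
apply: regularH_frac; rewrite ?size_polyX ?size_XsubC //; exact: param_den_neq0.
Qed.

(* d is the derivative of f at 0 with respect to the local parameter x / (x - l). *)
Definition tangent f d := exists E, [/\ regularH L E, E (Some 0) = d &
  forall p, onCurve L p -> f p = f (Some 0) + param p * E p].

(** The numerator of f - f(0) vanishes at 0, hence is x R; trading x for the parameter leaves E = R
    (x - l) / Q. *)
Lemma tangent_exists f : regularH L f -> exists d, tangent f d.
Proof.
move=> [N [P [Q [sP sQ PQ]]]]; set v := f (Some 0).
have [/= Q0 v0] := PQ _ G0; pose R0 := P - v *: Q.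
have /factor_theorem[R RE] : root R0 0.
  by rewrite /root hornerD hornerN hornerZ /v v0 divfK // subrr.
rewrite subr0 in RE.
have sR0 : (size R0 <= N.+1)%N.
  rewrite (leq_trans (size_polyD _ _)) // size_polyN geq_max sP.
  exact: leq_trans (size_scale_leq _ _) sQ.
have sR : (size R <= N)%N.
  have [->|R_0] := eqVneq R 0; first by rewrite size_poly0.
  by move: sR0; rewrite RE size_mulX.
have sRX : (size (R * ('X - l%:P))%R <= N.+1)%N.
  have [->|R_0] := eqVneq R 0; first by rewrite mul0r size_poly0.
  by rewrite size_Mmonic ?monicXsubC // size_XsubC addn2.
pose E p := hval N (R * ('X - l%:P)) p / hval N Q p.
exists (E (Some 0)), E; split=> // [|p Gp].
  by apply: regularH_frac => // p /PQ[].
have [Qp ->] := PQ p Gp; have D := param_den_neq0 Gp.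
have -> : hval N P p = hval N R0 p + v * hval N Q p.
  by rewrite -hvalZ -hvalD /R0 subrK.
have cross : hval N R0 p * hval 1 ('X - l%:P) p = hval 1 'X p * hval N (R * ('X - l%:P)) p.
  rewrite RE; case: (p) => [x|] /=; first by rewrite !hornerM hornerX; ring.
  by rewrite mulrBr !coefB coefC coefMC [R`_N]nth_default // mul0r coefX !subr0 mulr1 mul1r.
rewrite mulrDl mulfK // addrC /E /param mulf_div -cross -/v; congr (_ + _).
by field; rewrite Qp D.
Qed.

(** The parameter times E - E' is zero on the curve and the parameter is not identically zero, so E
    = E'. *)
Lemma tangent_unique f d d' : tangent f d -> tangent f d' -> d = d'.
Proof.
move=> [E [rE <- fE]] [E' [rE' <- fE']].
have [x Gx|t0|EE] := regular_domain regular_param (regularB rE rE').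
- rewrite mulrBr; apply/eqP; rewrite subr_eq0; apply/eqP/(addrI (f (Some 0))).
  by rewrite -fE // -fE'.
- have [x [Gx]] := exists_onCurve L [:: 0]; by rewrite inE -(param_eq0 Gx) t0 ?eqxx.
- by apply/eqP; rewrite -subr_eq0 EE.
Qed.

Lemma tangent_ext f f' d : (forall p, onCurve L p -> f p = f' p) -> tangent f d -> tangent f' d.
Proof. by move=> ff [E [rE E0 fE]]; exists E; split=> // p Gp; rewrite -!ff // fE. Qed.

Lemma tangent_const c : tangent (fun=> c) 0.
Proof. by exists (fun=> 0); split=> [|//|p _]; [apply: regular_const | rewrite mulr0 addr0]. Qed.

Lemma tangentD f f' d d' : tangent f d -> tangent f' d' -> tangent (fun p => f p + f' p) (d + d').
Proof.
move=> [E [rE E0 fE]] [E' [rE' E0' fE']]; exists (fun p => E p + E' p).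
split=> [||p Gp]; [exact: regularD | by rewrite E0 E0' |].
by rewrite [in LHS]fE // [f' p]fE' //; ring.
Qed.

Lemma tangentM f f' d d' : tangent f d -> tangent f' d' ->
  tangent (fun p => f p * f' p) (d * f' (Some 0) + f (Some 0) * d').
Proof.
move=> [E [rE E0 fE]] [E' [rE' E0' fE']].
exists (fun p => E p * f' (Some 0) + f (Some 0) * E' p + param p * (E p * E' p)).
split=> [||p Gp].
- apply: regularD; last by apply: regularM regular_param (regularM rE rE').
  by apply: regularD; apply: regularM => //; apply: regular_const.
- by rewrite param0 mul0r addr0 E0 E0'.
by rewrite [in LHS]fE // [f' p]fE' //; ring.
Qed.

Lemma tangent_param : tangent param 1.
Proof.
by exists (fun=> 1); split=> [|//|p _]; [apply: regular_const | rewrite param0 add0r mulr1].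
Qed.

Lemma tangent_ev2 f1 f2 d1 d2 (G : {poly {poly K}}) : tangent f1 d1 -> tangent f2 d2 ->
  tangent (fun p => ev2 G (f1 p) (f2 p))
    (ev2 (dX G) (f1 (Some 0)) (f2 (Some 0)) * d1 + ev2 G^`() (f1 (Some 0)) (f2 (Some 0)) * d2).
Proof.
move=> t1 t2; elim/poly2_ind: G => [c|||P Q tP tQ|P Q tP tQ].
- rewrite dXC !derivC polyC0 ev2_0 !mul0r addr0.
  by apply: tangent_ext (tangent_const c) => p _; rewrite ev2C.
- rewrite dXC derivX derivC polyC1 ev2_0 ev2_1 mul1r mul0r addr0.
  by apply: tangent_ext t1 => p _; rewrite ev2X.
- rewrite dX_Y derivX ev2_0 ev2_1 mul1r mul0r add0r.
  by apply: tangent_ext t2 => p _; rewrite ev2Y.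
- apply: (@tangent_ext (fun p => ev2 P (f1 p) (f2 p) + ev2 Q (f1 p) (f2 p))) => [p _|].
    by rewrite ev2D.
  by have := tangentD tP tQ; congr tangent; rewrite dXD derivD !ev2D; ring.
- apply: (@tangent_ext (fun p => ev2 P (f1 p) (f2 p) * ev2 Q (f1 p) (f2 p))) => [p _|].
    by rewrite ev2M.
  by have := tangentM tP tQ; congr tangent; rewrite dXM derivM !ev2E; ring.
Qed.

Lemma tangent_comp g (z : K) f d : z != 0 -> autCurve L g -> g None = None ->
  (forall x, g (Some x) = Some (z * x)) -> tangent f d -> tangent (f \o g) (z * d).
Proof.
move=> z0 [gM gL] gi gx [E [rE E0 fE]].
(* [u] is the quotient of the parameter composed with [g] by the parameter; u(0) = z. Its pole l / z
   is sent by [g] to [l], so it is off the curve. *)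
pose u p := hval 1 (z *: ('X - l%:P)) p / hval 1 (z *: 'X - l%:P) p.
have den0 p : onCurve L p -> hval 1 (z *: 'X - l%:P) p != 0.
  case: p => [x|] Gp /=; last by rewrite coefB coefZ coefX coefC subr0 mulr1.
  rewrite hornerD hornerN hornerZ hornerX hornerC subr_eq0.
  by apply: contraNneq Gp => zx; rewrite -gL gx zx.
have ru : regularH L u.
  apply: regularH_frac => //.
    by rewrite (leq_trans (size_scale_leq _ _)) // size_XsubC.
  rewrite (leq_trans (size_polyD _ _)) // size_polyN geq_max.
  by rewrite (leq_trans (size_scale_leq _ _)) ?size_polyX // size_polyC; case: eqP.
exists (fun p => u p * E (g p)); split=> [||p Gp].
- by apply: regularM ru (regular_mob gM _ rE) => p; rewrite gL.
- rewrite gx mulr0 E0 /u /= !(hornerD, hornerN, hornerZ, hornerX, hornerC); congr (_ * d).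
  by rewrite mulr0 !sub0r mulrN invrN mulrNN mulfK.
have Ggp : onCurve L (g p) by rewrite /onCurve gL.
rewrite /= fE // gx mulr0; congr (_ + _); rewrite mulrA; congr (_ * _).
have := den0 _ Gp; have := param_den_neq0 Gp; rewrite /param /u.
case: (p) => [x|]; rewrite ?gx ?gi /=.
  rewrite !(hornerD, hornerN, hornerZ, hornerX, hornerC) => D1 D2.
  by field; rewrite D1 D2.
rewrite !(coefB, coefZ, coefX, coefC) /= !subr0 !mulr1 => _ z0'.
by rewrite divr1 divff ?mul1r.
Qed.

End Tangent.

(** * The Jacobian at a fixed point *)

Section NoEmbedding.
Variable K : closedFieldType.
Implicit Types (L : seq (option K)) (g : option K -> option K).

(** The matrix acts by z on the line spanned by a. As w kills a, it is a coordinate on the quotient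
    by that line, where the matrix acts by c; so the determinant is z c. *)
Lemma det_of_eigen_aux (m11 m12 m21 m22 a1 a2 w1 w2 z c : K) :
  a1 != 0 -> (w1 != 0) || (w2 != 0) -> w1 * a1 + w2 * a2 = 0 ->
  m11 * a1 + m12 * a2 = z * a1 -> m21 * a1 + m22 * a2 = z * a2 ->
  w1 * m12 + w2 * m22 = c * w2 -> m11 * m22 - m12 * m21 = z * c.
Proof.
move=> a10 w0 wa e1 e2 e3.
have w20 : w2 != 0.
  apply: contraTneq w0 => w20; move: wa; rewrite w20 mul0r addr0 => /eqP.
  by rewrite mulf_eq0 (negPf a10) orbF eqxx orbF => ->.
have e4 : m22 * a1 - m12 * a2 = c * a1.
  apply: (mulfI w20); transitivity (a1 * (w1 * m12 + w2 * m22) - m12 * (w1 * a1 + w2 * a2)).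
    by ring.
  by rewrite wa e3; ring.
apply: (mulIf a10); transitivity (m22 * (m11 * a1 + m12 * a2) - m12 * (m21 * a1 + m22 * a2)).
  by ring.
by rewrite e1 e2 -mulrA -e4; ring.
Qed.

Lemma det_of_eigen (m11 m12 m21 m22 a1 a2 w1 w2 z c : K) :
  (a1 != 0) || (a2 != 0) -> (w1 != 0) || (w2 != 0) -> w1 * a1 + w2 * a2 = 0 ->
  m11 * a1 + m12 * a2 = z * a1 -> m21 * a1 + m22 * a2 = z * a2 ->
  w1 * m11 + w2 * m21 = c * w1 -> w1 * m12 + w2 * m22 = c * w2 ->
  m11 * m22 - m12 * m21 = z * c.
Proof.
case/orP=> a0 w0 wa e1 e2 e3 e4; first exact: det_of_eigen_aux a0 w0 wa e1 e2 e4.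
rewrite mulrC [m12 * _]mulrC; apply: (@det_of_eigen_aux _ _ _ _ a2 a1 w2 w1) => //;
  by rewrite 1?orbC // addrC.
Qed.

Definition vanishes L (f1 f2 : option K -> K) (G : {poly {poly K}}) :=
  forall p, onCurve L p -> ev2 G (f1 p) (f2 p) = 0.

(* The tangent line of the curve at the fixed point is an eigenspace of dh for z, and the
   conormal line, spanned by dF, is an eigenspace of its transpose for c. *)
Lemma jac_at_fixed_point L g (l z c : K) (f1 f2 : option K -> K) (h1 h2 F : {poly {poly K}}) :
  Some l \in L -> onCurve L (Some 0) -> z != 0 -> autCurve L g -> g None = None ->
  (forall x, g (Some x) = Some (z * x)) -> closedEmb L f1 f2 ->
  (forall p, onCurve L p -> ev2 h1 (f1 p) (f2 p) = f1 (g p) /\ ev2 h2 (f1 p) (f2 p) = f2 (g p)) ->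
  vanishes L f1 f2 F -> (forall G, vanishes L f1 f2 G -> exists Q, G = Q * F) ->
  (forall x y, ev2 F (ev2 h1 x y) (ev2 h2 x y) = c * ev2 F x y) ->
  jac h1 h2 (f1 (Some 0)) (f2 (Some 0)) = z * c.
Proof.
move=> Ll G0 z0 gA gi gx [/regularP r1 /regularP r2 surj] hg F0 genF Fh.
have [d1 t1] := tangent_exists Ll G0 r1; have [d2 t2] := tangent_exists Ll G0 r2.
set a1 := f1 (Some 0); set a2 := f2 (Some 0).
have uniq f d d' := @tangent_unique _ _ _ Ll G0 f d d'.
have tev G := tangent_ev2 Ll G0 G t1 t2; rewrite -/a1 -/a2 in tev.
(* [T] restricts to the local parameter, so its derivative along (d1, d2) is 1: the tangent vector
   is nonzero. *)
have [|T hT] := surj (param l); first exact/regularP/regular_param.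
have dT : ev2 (dX T) a1 a2 * d1 + ev2 T^`() a1 a2 * d2 = 1.
  by apply: uniq (tev T) (tangent_ext G0 _ (tangent_param L l)).
have d0 : (d1 != 0) || (d2 != 0).
  rewrite -negb_and; apply/negP => /andP[/eqP d10 /eqP d20].
  by move: dT; rewrite d10 d20 !mulr0 addr0 => /esym/eqP; rewrite oner_eq0.
have [h1a h2a] : ev2 h1 a1 a2 = a1 /\ ev2 h2 a1 a2 = a2.
  by have := hg _ G0; rewrite gx mulr0.
have dh1 : ev2 (dX h1) a1 a2 * d1 + ev2 h1^`() a1 a2 * d2 = z * d1.
  apply: uniq (tev h1) _.
  by apply: (tangent_ext G0 _ (tangent_comp Ll G0 z0 gA gi gx t1)) => p /hg[e1 e2] /=.
have dh2 : ev2 (dX h2) a1 a2 * d1 + ev2 h2^`() a1 a2 * d2 = z * d2.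
  apply: uniq (tev h2) _.
  by apply: (tangent_ext G0 _ (tangent_comp Ll G0 z0 gA gi gx t2)) => p /hg[e1 e2] /=.
have dFd : ev2 (dX F) a1 a2 * d1 + ev2 F^`() a1 a2 * d2 = 0.
  by apply: uniq (tev F) (tangent_ext G0 _ (tangent_const L l 0)) => p /F0.
have Fa : ev2 F a1 a2 = 0 by apply: F0.
(* If dF were zero at the point, every multiple of [F] would have zero differential there. But [H]
   below vanishes on the curve and has differential (d2, - d1). *)
have dF0 : (ev2 (dX F) a1 a2 != 0) || (ev2 F^`() a1 a2 != 0).
  rewrite -negb_and; apply/negP => /andP[/eqP Fx /eqP Fy].
  have [E1 [rE1 E10 fE1]] := t1; have [E2 [rE2 E20 fE2]] := t2.
  have [|T' hT'] := surj (fun p => d2 * E1 p - d1 * E2 p).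
    by apply/regularP; apply: regularB; apply: regularM => //; apply: regular_const.
  (* On the curve the linear part of [H] equals the parameter times d2 E1 - d1 E2, that is, T T'.
     Both [T] and [T'] vanish at the point, so their product adds nothing to the differential. *)
  pose H : {poly {poly K}} := d2%:P%:P * (('X)%:P - a1%:P%:P) - d1%:P%:P * ('X - a2%:P%:P) - T * T'.
  have [p Gp|Q HQ] := genF H.
    rewrite !ev2E -hT // -hT' // fE1 // fE2 // -/a1 -/a2; ring.
  have Ta : ev2 T a1 a2 = 0 by rewrite -hT // param0.
  have T'a : ev2 T' a1 a2 = 0 by rewrite -hT' // E10 E20 mulrC subrr.
  have : dX H = dX Q * F + Q * dX F by rewrite HQ dXM.
  have : H^`() = Q^`() * F + Q * F^`() by rewrite HQ derivM.
  move=> /(congr1 (fun P => ev2 P a1 a2)) + /(congr1 (fun P => ev2 P a1 a2)).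
  rewrite !ev2E Fa Fx Fy.
  have dXB P P' : dX (P - P') = dX P - dX P' :> {poly {poly K}}.
    by apply/eqP; rewrite eq_sym subr_eq -dXD subrK.
  rewrite /H !(dXB, dXM, dXC, dX_Y, derivB, derivM, derivC, derivX, polyC0, polyC1).
  rewrite !ev2E Ta T'a !(mulr0, mul0r, addr0, add0r, oppr0, subr0, sub0r, mulr1) => /eqP.
  by rewrite oppr_eq0 => /eqP d10 d20; move: d0; rewrite d10 d20 eqxx.
(* Differentiating F o h = c F at the fixed point makes dF an eigenvector of the transpose of dh. *)
have [W [w wx wy]] := comp2 F h1 h2.
have WE : W = c%:P%:P * F by apply: ev2_ext => x y; rewrite w Fh ev2M ev2C.
have := wx a1 a2; have := wy a1 a2.
rewrite WE dXM dXC derivM !derivC polyC0 !ev2E h1a h2a !mul0r !add0r => ey ex.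
rewrite /jac; move: d0 dF0 dFd dh1 dh2 (esym ex) (esym ey); exact: det_of_eigen.
Qed.

(** The ideal is prime since regular functions have no zero divisors, nonzero by
    [algebraic_dependence], and not that of a point since the embedding separates 0 from other
    points through [param]. *)
Lemma curve_ideal_principal L (l : K) (f1 f2 : option K -> K) :
  Some l \in L -> onCurve L (Some 0) -> closedEmb L f1 f2 ->
  exists F, [/\ F != 0, vanishes L f1 f2 F &
    forall G, vanishes L f1 f2 G -> exists Q, G = Q * F].
Proof.
move=> Ll G0 [/regularP r1 /regularP r2 surj].
have rG G := regular_ev2 G r1 r2.
have [P0 [P00 IP0]] := algebraic_dependence r1 r2.
have [||||r s [Ir Is]||F [IF genF]] := @prime_ideal_principal K (vanishes L f1 f2).
- by move=> P Q IP IQ p Gp; rewrite ev2B IP // IQ // subrr.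
- by move=> P Q IQ p Gp; rewrite ev2M IQ // mulr0.
- by move/(_ _ G0)/eqP; rewrite ev2_1 oner_eq0.
- move=> P Q IPQ; apply: (regular_domain (rG P) (rG Q)) => x Gx.
  by rewrite -ev2M IPQ.
- have [|T hT] := surj (param l); first exact/regularP/regular_param.
  have fr p : onCurve L p -> f1 p = r /\ f2 p = s.
    move=> Gp; move/eqP: (Ir p Gp); move/eqP: (Is p Gp).
    by rewrite polyCB !ev2E !subr_eq0 => /eqP-> /eqP->.
  have [x [Gx]] := exists_onCurve L [:: 0]; rewrite inE -(param_eq0 Ll Gx) hT //.
  have [-> ->] := fr _ Gx; have [<- <-] := fr _ G0.
  by rewrite -hT // param0 eqxx.
- by exists P0.
exists F; split=> //; apply: contraNneq P00 => F0.
by have [Q ->] := genF P0 IP0; rewrite F0 mulr0.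
Qed.

(* F o h and F o h^-1 vanish on the curve, hence are multiples of F. *)
Lemma curve_equation_semiinvariant L g (f1 f2 : option K -> K) (F h1 h2 : {poly {poly K}}) :
  (forall p, (g p \in L) = (p \in L)) -> (forall p, exists q, g q = p) ->
  F != 0 -> vanishes L f1 f2 F -> (forall G, vanishes L f1 f2 G -> exists Q, G = Q * F) ->
  polyAut h1 h2 ->
  (forall p, onCurve L p -> ev2 h1 (f1 p) (f2 p) = f1 (g p) /\ ev2 h2 (f1 p) (f2 p) = f2 (g p)) ->
  exists2 c : K, c != 0 & forall x y, ev2 F (ev2 h1 x y) (ev2 h2 x y) = c * ev2 F x y.
Proof.
move=> gL gS F0 IF genF [k1 [k2 hk]] hg.
have [W [w _ _]] := comp2 F h1 h2; have [W' [w' _ _]] := comp2 F k1 k2.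
have [p Gp|C WE] := genF W.
  by rewrite w; have [-> ->] := hg p Gp; apply: IF; rewrite /onCurve gL.
have [p Gp|C' W'E] := genF W'.
  have [q gq] := gS p; have Gq : onCurve L q by rewrite /onCurve -gL gq.
  rewrite w' -gq; have [<- <-] := hg q Gq.
  by have [-> -> _ _] := hk (f1 q) (f2 q); apply: IF.
(* Composing F o h^-1 = C' F with h gives F = (C' o h) C F, so [C] is a unit. *)
have [Z [z _ _]] := comp2 C' h1 h2.
have CZ : C * Z = 1.
  apply: (mulIf F0); rewrite mul1r mulrAC -WE; apply: ev2_ext => x y.
  by rewrite ev2M w z mulrC -ev2M -W'E w'; have [-> -> _ _] := hk x y.
have [c c0 CE] := unit_poly2 CZ.
by exists c => // x y; rewrite -w WE CE ev2M ev2C.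
Qed.

(** Exchanges 0 and infinity, so that [jac_at_fixed_point], stated at 0, applies at infinity as
    well. *)
Lemma inversion_mobius : exists s : option K -> option K,
  [/\ isMobius s, involutive s, s (Some 0) = None, s None = Some 0 &
      forall x, x != 0 -> s (Some x) = Some x^-1].
Proof.
have D : (0 : K) * 0 - 1 * 1 != 0 by rewrite mul0r sub0r mulr1 oppr_eq0 oner_neq0.
exists (mob 0 1 1 0); split=> [|p|||x x0] /=.
- by exists 0, 1, 1, 0.
- rewrite mob_comp //.
  by rewrite !mul0r !mulr0 !mulr1 !addr0 !add0r mob_scalar ?oner_neq0.
- by rewrite mulr0 addr0 eqxx.
- by rewrite oner_eq0 mul0r.
- by rewrite !mul1r mul0r addr0 add0r (negPf x0) div1r.
Qed.

Lemma multiplier_sqr L g (z : K) (f1 f2 : option K -> K) :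
  L != [::] -> onCurve L (Some 0) -> onCurve L None -> z != 0 -> autCurve L g -> g None = None ->
  (forall x, g (Some x) = Some (z * x)) -> closedEmb L f1 f2 -> extendsAlong L f1 f2 g ->
  z ^+ 2 = 1.
Proof.
move=> L0 G0 Gi z0 gA gi gx fE [h1 [h2 [hA hg]]].
have [l Ll] : exists l, Some l \in L.
  move: L0 Gi; case: (L) => // -[l|] s _; last by rewrite /onCurve mem_head.
  by exists l; rewrite mem_head.
have [F [F0 IF genF]] := curve_ideal_principal Ll G0 fE.
have gS p : exists q, g q = p.
  case: p => [x|]; last by exists None.
  by exists (Some (x / z)); rewrite gx mulrC divfK.
have [c c0 Fh] := curve_equation_semiinvariant gA.2 gS F0 IF genF hA hg.
have [J hJ] := jac_const hA.
have Jz : J = z * c.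
  by rewrite -(jac_at_fixed_point Ll G0 z0 gA gi gx fE hg IF genF Fh) hJ.
have [s [sM sK s0 si sx]] := inversion_mobius; pose L' := map s L.
have LL' p : (p \in L') = (s p \in L) by apply: mem_map_can.
have GG' p : onCurve L' p = onCurve L (s p) by rewrite /onCurve LL'.
have l0 : l != 0 by apply: contraNneq G0 => <-.
(* In the inverted coordinate the multiplier is 1 / z, while [h1], [h2], [F] and [c] stay the
   same. *)
have Jz' : J = z^-1 * c.
  rewrite -(@jac_at_fixed_point L' (s \o g \o s) l^-1 z^-1 c (f1 \o s) (f2 \o s) h1 h2 F) //.
  - by rewrite LL' sx ?invr_eq0 // invrK.
  - by rewrite GG' s0.
  - by rewrite invr_eq0.
  - exact: (autCurve_mobius sM sM sK LL' gA).
  - by rewrite /= si gx mulr0 s0.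
  - move=> x; have [->|x0] := eqVneq x 0; first by rewrite /= s0 gi si mulr0.
    by rewrite /= sx // gx sx ?mulf_neq0 ?invr_eq0 // invfM invrK.
  - exact: (closedEmb_mobius sM sM sK sK LL' fE).
  - by move=> p; rewrite GG' => Gp; rewrite /= sK; apply: hg.
  - by move=> p; rewrite GG' => Gp; apply: IF.
  - by move=> G IG; apply: genF => p Gp; have := IG (s p); rewrite /= GG' sK; apply.
apply: (mulfI c0); rewrite mulr1 expr2 mulrA [c * z]mulrC -Jz Jz'.
by rewrite mulrAC mulVf // mul1r.
Qed.

Lemma no_extension_of_odd_order L g (n : nat) : L != [::] -> autCurve L g ->
  (1 < n)%N -> odd n -> hasOrder g n -> fixesExactlyTwo L g ->
  ~ exists f1 f2 : option K -> K, closedEmb L f1 f2 /\ extendsAlong L f1 f2 g.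
Proof.
move=> L0 gA n_gt1 odd_n [_ [gn gmin]] [p [q [[Gp Gq] pq gp gq _]]] [f1 [f2 [fE fg]]].
have [m [m' [[mm mm' mK m'K] [mi m0]]]] := exists_mobius pq.
pose L' := map m' L; have LL' r : (r \in L') = (m r \in L) by apply: mem_map_can.
have g'A := autCurve_mobius mm mm' m'K LL' gA.
have g'i : (m' \o g \o m) None = None by rewrite /= mi gq -mi mK.
have [z [b [z0 g'x]]] := mobius_fixing_infinity g'A.1 g'i.
have b0 : b = 0.
  have := g'x 0; rewrite /= m0 gp -m0 mK mulr0 add0r.
  by case.
have {}g'x x : (m' \o g \o m) (Some x) = Some (z * x) by rewrite g'x b0 addr0.
have z2 : z ^+ 2 = 1.
  have G'0 : onCurve L' (Some 0) by rewrite /onCurve LL' m0.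
  have G'i : onCurve L' None by rewrite /onCurve LL' mi.
  have L'0 : L' != [::] by rewrite /L'; case: (L) L0.
  have f'E := closedEmb_mobius mm mm' mK m'K LL' fE.
  have f'g := extendsAlong_mobius m'K LL' fg.
  exact: (multiplier_sqr L'0 G'0 G'i z0 g'A g'i g'x f'E f'g).
have gm r : g (m r) = m ((m' \o g \o m) r) by rewrite /= m'K.
have g2 r : g (g r) = r.
  rewrite -(m'K r) gm gm; congr m; case: (m' r) => [x|]; rewrite ?g'i //.
  by rewrite !g'x mulrA -expr2 z2 mul1r.
have g2k k r : iter k.*2 g r = r by elim: k => //= k IH; rewrite IH g2.
(* Since 1 < n, some point is moved by [g]; but n is odd and g^2 is the identity, so g = g^n is the
   identity. *)
have [r []] := gmin 1%N n_gt1.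
by rewrite /= -{2}(gn r) -(odd_double_half n) odd_n /= g2k.
Qed.

End NoEmbedding.

Theorem mainTheorem6 (K : closedFieldType) (hK : [pchar K] =i pred0)
  (L : seq (option K)) (hL : L != [::])
  (g : option K -> option K) (hg : autCurve L g) :
  (fixesAtMostOne L g ->
     exists f1 f2 : option K -> K, closedEmb L f1 f2 /\ extendsAlong L f1 f2 g) /\
  (forall n : nat, (1 < n)%N -> odd n -> hasOrder g n -> fixesExactlyTwo L g ->
     ~ exists f1 f2 : option K -> K, closedEmb L f1 f2 /\ extendsAlong L f1 f2 g).
Proof.
split=> [|n]; first exact: extends_of_fixesAtMostOne.
exact: no_extension_of_odd_order.
Qed.
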